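(* Let $A\in\mathbb{C}^{n\times n}$, $B\in\mathbb{C}^{n\times m}$, $C\in\mathbb{C}^{p\times n}$, and for $X\in\mathbb{C}^{n\times n}$ let $\mathcal{R}(X)=A^HX+XA+C^HC-XBB^HX$. Let $j<n$ be a positive integer such that the $jp$ columns of the matrix $[C^H,\ A^HC^H,\ \ldots,\ (A^H)^{j-1}C^H]$ are linearly independent. Let $\mathfrak{q}_j$ be a polynomial of degree $j$ with roots $s_1,\ldots,s_j\in\mathbb{C}_+$ (the open right half plane), put $\mathcal{S}_j=\{s_1,\ldots,s_j\}$, and assume $\mathcal{S}_j\cap\Lambda(A^H)=\emptyset$. Suppose that $$A^H\,[\,C^H\ \ Z_j\,]\begin{bmatrix}0\\ I_{jp}\end{bmatrix}=[\,C^H\ \ Z_j\,]\begin{bmatrix}h_j\\ \underline{H}_{-j}\end{bmatrix},\qquad h_j\in\mathbb{C}^{p\times jp},\ \underline{H}_{-j}\in\mathbb{C}^{jp\times jp},$$ is a block rational Arnoldi decomposition (BRAD) with poles $s_1,\ldots,s_j$, where $Z_j\in\mathbb{C}^{n\times jp}$ satisfies $\operatorname{blockspan}(Z_j)=\mathfrak{K}_j^\Box(A^H,C^H,\mathcal{S}_j)$. Denote by $Y_j\in\mathbb{C}^{jp\times jp}$ the unique (Hermitian) positive definite solution of $$\underline{H}_{-j}Y_j+Y_j\underline{H}_{-j}^H-Y_j\left(Z_j^HBB^HZ_j+h_j^Hh_j\right)Y_j=0 .$$ Then $X_j=Z_jY_jZ_j^H$ is the unique matrix of rank $jp$ of the form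 $Z_jYZ_j^H$ with $Y\in\mathbb{C}^{jp\times jp}$ Hermitian such that the residual $\mathcal{R}(X_j)$ is of rank $p$. That is, $X_j$ has rank $jp$ and $\operatorname{rank}\mathcal{R}(X_j)=p$, and if $Y\in\mathbb{C}^{jp\times jp}$ is Hermitian with $\operatorname{rank}(Z_jYZ_j^H)=jp$ and $\operatorname{rank}\mathcal{R}(Z_jYZ_j^H)=p$, then $Z_jYZ_j^H=X_j$.
   Context: Notation: $M^H$ is the conjugate transpose and $\Lambda(M)$ the spectrum of $M$. Standing assumptions of the paper: $B$ has full column rank, $C$ has full row rank, and the Riccati equation $\mathcal{R}(X)=0$ has a unique stabilizing solution $X=X^H$ (it is positive semidefinite and $A-BB^HX$ is stable). Block Krylov spaces: for $F\in\mathbb{C}^{n\times n}$ and $\mathbf{v}\in\mathbb{C}^{n\times p}$, $\kappa_j^\Box(F,\mathbf{v})=\{\sum_{k=0}^{j-1}F^k\mathbf{v}\,\mathfrak{F}_k : \mathfrak{F}_k\in\mathbb{C}^{p\times p}\}\subset\mathbb{C}^{n\times p}$. For a polynomial $\mathfrak{q}_j$ of degree $j$ with roots $\mathcal{S}_j=\{s_1,\ldots,s_j\}$ (listed with multiplicity) disjoint from $\Lambda(F)$, the block rational Krylov subspace is $\mathfrak{K}_j^\Box(F,\mathbf{v},\mathcal{S}_j)=\mathfrak{q}_j(F)^{-1}\kappa_j^\Box(F,\mathbf{v})$. For $Z=[Z^{(1)},\ldots,Z^{(j)}]$ with $Z^{(i)}\in\mathbb{C}^{n\times p}$, $\operatorname{blockspan}(Z)=\{\sum_{i=1}^jZ^{(i)}\mathfrak{F}_i:\mathfrak{F}_i\in\mathbb{C}^{p\times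 p}\}$. BRAD: a relation $FV_{j+1}\underline{K}_j=V_{j+1}\underline{H}_j$ is a block rational Arnoldi decomposition if $V_{j+1}\in\mathbb{C}^{n\times(j+1)p}$ has full column rank; $\underline{H}_j,\underline{K}_j$ are block upper Hessenberg of size $(j+1)p\times jp$ (with $p\times p$ blocks $H_{ik},K_{ik}$) such that for each $i=1,\ldots,j$ at least one of $H_{i+1,i},K_{i+1,i}$ is nonsingular and $\beta_iK_{i+1,i}=\gamma_iH_{i+1,i}$ for scalars $\beta_i,\gamma_i\in\mathbb{C}$ with $|\beta_i|+|\gamma_i|\neq0$; and the quotients $\mu_i=\beta_i/\gamma_i$, called the poles of the BRAD, lie outside $\Lambda(F)$. In the present situation $F=A^H$, $V_{j+1}=[\,C^H\ \ Z_j\,]$, $\underline{K}_j=\begin{bmatrix}0\\ I_{jp}\end{bmatrix}$ and $\underline{H}_j=\begin{bmatrix}h_j\\ \underline{H}_{-j}\end{bmatrix}$, where $h_j$ is the first block row of $\underline{H}_j$; thus $\underline{H}_{-j}$ is block upper triangular with diagonal blocks $\mu_1I_p,\ldots,\mu_jI_p$, where $\mu_1,\ldots,\mu_j$ are the poles, i.e. $s_1,\ldots,s_j$. *)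

(* Defs.v *)
From HB Require Import structures.
From mathcomp Require Export all_boot all_order all_algebra.
From mathcomp Require Export sesquilinear spectral.
From mathcomp Require Export classical_sets reals complex.

Set Implicit Arguments.
Unset Strict Implicit.
Unset Printing Implicit Defensive.

Export Order.TTheory GRing.Theory Num.Theory.
Open Scope classical_set_scope.
Open Scope sesquilinear_scope.
Open Scope ring_scope.

(* [M ^t*] is the conjugate transpose and [M \is hermsymmx] means [M ^t* = M].
   [eigenvalue M] uses row eigenvectors, which gives the same spectrum. *)

Definition posdefmx (C : numClosedFieldType) (n : nat) (Y : 'M[C]_n) : Prop :=
  Y \is hermsymmx /\
  forall x : 'cV[C]_n, x != 0 -> 0 < (x^t* *m Y *m x) 0 0.

Definition possemidefmx (C : numClosedFieldType) (n : nat) (Y : 'M[C]_n) : Prop :=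
  Y \is hermsymmx /\ forall x : 'cV[C]_n, 0 <= (x^t* *m Y *m x) 0 0.

Definition full_col_rank (C : numClosedFieldType) (m n : nat) (M : 'M[C]_(m, n)) :=
  \rank M = n.

Definition full_row_rank (C : numClosedFieldType) (m n : nat) (M : 'M[C]_(m, n)) :=
  \rank M = m.

Definition stablemat (C : numClosedFieldType) (n : nat) (M : 'M[C]_n) : Prop :=
  forall z : C, eigenvalue M z -> 'Re z < 0.

Definition riccati (C : numClosedFieldType) (n m p : nat)
    (A : 'M[C]_n) (B : 'M[C]_(n, m)) (Cm : 'M[C]_(p, n)) (X : 'M[C]_n) : 'M[C]_n :=
  A^t* *m X + X *m A + Cm^t* *m Cm - X *m B *m B^t* *m X.

Definition stabilizing_solution (C : numClosedFieldType) (n m p : nat)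
    (A : 'M[C]_n) (B : 'M[C]_(n, m)) (Cm : 'M[C]_(p, n)) (X : 'M[C]_n) : Prop :=
  [/\ X \is hermsymmx, riccati A B Cm X = 0 & stablemat (A - B *m B^t* *m X)].

Definition standing_assumptions (C : numClosedFieldType) (n m p : nat)
    (A : 'M[C]_n) (B : 'M[C]_(n, m)) (Cm : 'M[C]_(p, n)) : Prop :=
  [/\ full_col_rank B, full_row_rank Cm &
      exists X : 'M[C]_n,
        [/\ stabilizing_solution A B Cm X, possemidefmx X &
            forall X' : 'M[C]_n, stabilizing_solution A B Cm X' -> X' = X]].

(* Indices of a block-partitioned dimension: position [a] inside the [i]-th
   block of size [p].  As [j.+1 * p] is convertible to [p + j * p], block [ord0]
   of [col_mx M N : 'M_(p + j * p, _)] is [M], and block [lift ord0 i] is the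
   [i]-th block row of [N]; likewise for [row_mx]. *)
Lemma blkidx_subproof (j p : nat) (i : 'I_j) (a : 'I_p) : (i * p + a < j * p)%N.
Proof.
apply: (@leq_trans (i.+1 * p)%N); first by rewrite mulSn addnC ltn_add2r.
by rewrite leq_mul2r ltn_ord orbT.
Qed.

Definition blkidx (j p : nat) (i : 'I_j) (a : 'I_p) : 'I_(j * p) :=
  Ordinal (blkidx_subproof i a).

Definition blk (C : numClosedFieldType) (p j k : nat)
    (M : 'M[C]_(j * p, k * p)) (i : 'I_j) (l : 'I_k) : 'M[C]_p :=
  mxsub (blkidx i) (blkidx l) M.

Definition blkcol (C : numClosedFieldType) (n p j : nat)
    (Z : 'M[C]_(n, j * p)) (i : 'I_j) : 'M[C]_(n, p) :=
  colsub (blkidx i) Z.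

Definition blockspan (C : numClosedFieldType) (n p j : nat)
    (Z : 'M[C]_(n, j * p)) : set 'M[C]_(n, p) :=
  [set W | exists G : 'I_j -> 'M[C]_p, W = \sum_(i < j) blkcol Z i *m G i].

(* [horner_mx] is only defined on square matrices of successor dimension. *)
Definition block_krylov (C : numClosedFieldType) (n p j : nat)
    (F : 'M[C]_n.+1) (v : 'M[C]_(n.+1, p)) : set 'M[C]_(n.+1, p) :=
  [set W | exists G : 'I_j -> 'M[C]_p, W = \sum_(k < j) F ^+ k *m v *m G k].

Definition rational_krylov (C : numClosedFieldType) (n p j : nat)
    (F : 'M[C]_n.+1) (v : 'M[C]_(n.+1, p)) (q : {poly C}) : set 'M[C]_(n.+1, p) :=
  [set invmx (horner_mx F q) *m W | W in block_krylov j F v].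

Definition krylov_mx (C : numClosedFieldType) (n p j : nat)
    (F : 'M[C]_n.+1) (v : 'M[C]_(n.+1, p)) : 'M[C]_(n.+1, \sum_(k < j) p) :=
  \mxrow_(k < j) (F ^+ k *m v).

Definition block_hessenberg (C : numClosedFieldType) (p j : nat)
    (M : 'M[C]_(j.+1 * p, j * p)) : Prop :=
  forall (i : 'I_j.+1) (k : 'I_j), (k.+1 < i)%N -> blk M i k = 0.

Definition subdiag_blk (C : numClosedFieldType) (p j : nat)
    (M : 'M[C]_(j.+1 * p, j * p)) (i : 'I_j) : 'M[C]_p :=
  blk M (lift ord0 i) i.

(* The poles are [beta i / gamma i]; a pole with [gamma i = 0] is infinite and
   hence never in the spectrum. *)
Definition is_BRAD (C : numClosedFieldType) (n p j : nat) (F : 'M[C]_n)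
    (V : 'M[C]_(n, j.+1 * p)) (K H : 'M[C]_(j.+1 * p, j * p))
    (beta gamma : 'I_j -> C) : Prop :=
  F *m V *m K = V *m H /\ full_col_rank V /\
  block_hessenberg K /\ block_hessenberg H /\
  forall i : 'I_j,
    [/\ subdiag_blk H i \in unitmx \/ subdiag_blk K i \in unitmx,
        beta i *: subdiag_blk K i = gamma i *: subdiag_blk H i,
        `|beta i| + `|gamma i| != 0 &
        gamma i != 0 -> ~~ eigenvalue F (beta i / gamma i)].

Definition BRAD_with_poles (C : numClosedFieldType) (n p j : nat) (F : 'M[C]_n)
    (V : 'M[C]_(n, j.+1 * p)) (K H : 'M[C]_(j.+1 * p, j * p))
    (s : 'I_j -> C) : Prop :=
  exists beta gamma : 'I_j -> C,
    is_BRAD F V K H beta gamma /\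
    forall i : 'I_j, gamma i != 0 /\ s i = beta i / gamma i.

Definition posdef_riccati_solution (C : numClosedFieldType) (n m p j : nat)
    (B : 'M[C]_(n, m)) (Z : 'M[C]_(n, j * p)) (h : 'M[C]_(p, j * p))
    (H : 'M[C]_(j * p)) (Y : 'M[C]_(j * p)) : Prop :=
  posdefmx Y /\
  H *m Y + Y *m H^t*
    - Y *m (Z^t* *m B *m B^t* *m Z + h^t* *m h) *m Y = 0.

(* Main.v *)
(* By the recurrence A^t* Z = C^t* h + Z H, the residual at Z Y Z^t* factors as
   V M V^t* with V = [C^t* Z] of full column rank and M a block matrix with
   corner 1; the Schur complement of that corner is the left-hand side of the
   reduced Riccati equation.  So the residual has rank p exactly when Y solves
   that equation.  An invertible Y solves it exactly when W = Y^-1 solves the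
   Lyapunov equation W H + H^t* W = G^t* G with G = [B^t* Z; h].  As H is upper
   triangular with diagonal in the right half plane, W exists and is unique;
   as no pole is an eigenvalue of A^t*, (H, G) is observable, which makes W
   positive definite. *)
From HB Require Import structures.
From mathcomp Require Import zify.
Require Import Defs.

Set Implicit Arguments.
Unset Strict Implicit.
Unset Printing Implicit Defensive.

(** * Conjugate transposes, and ranks under multiplication and elimination *)

Section ConjTranspose.
Variable F : numClosedFieldType.

Lemma trmxC_mul m n p (A : 'M[F]_(m, n)) (B : 'M[F]_(n, p)) :
  (A *m B)^t* = B^t* *m A^t*.
Proof. by rewrite trmx_mul map_mxM. Qed.

Lemma trmxCD m n (A B : 'M[F]_(m, n)) : (A + B)^t* = A^t* + B^t*.
Proof. by rewrite linearD /= map_mxD. Qed.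

Lemma trmxC1 n : (1%:M : 'M[F]_n)^t* = 1%:M.
Proof. by rewrite trmx1 map_mx1. Qed.

Lemma trmxC0 m n : (0 : 'M[F]_(m, n))^t* = 0.
Proof. by rewrite trmx0 map_mx0. Qed.

Lemma mxrank_trmxC m n (A : 'M[F]_(m, n)) : \rank (A^t*) = \rank A.
Proof. by rewrite mxrank_map mxrank_tr. Qed.

Lemma hermsymmxP n (A : 'M[F]_n) : reflect (A^t* = A) (A \is hermsymmx).
Proof. by rewrite is_hermitianmxE expr0 scale1r eq_sym; apply: eqP. Qed.

Lemma invmx_hermsym n (A : 'M[F]_n) :
  A \is hermsymmx -> invmx A \is hermsymmx.
Proof.
move=> /hermsymmxP hA; apply/hermsymmxP.
by rewrite trmx_inv map_invmx hA.
Qed.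

Lemma mxrankMfull m n p (A : 'M[F]_(m, n)) (B : 'M[F]_(n, p)) :
  full_col_rank A -> \rank (A *m B) = \rank B.
Proof.
move=> hA; rewrite -mxrank_tr trmx_mul mxrankMfree ?mxrank_tr //.
by rewrite /row_free mxrank_tr; apply/eqP.
Qed.

Lemma full_col_rank_inj m n p (A : 'M[F]_(m, n)) (B : 'M[F]_(n, p)) :
  full_col_rank A -> A *m B = 0 -> B = 0.
Proof.
by move=> hA hAB; apply/eqP; rewrite -mxrank_eq0 -(mxrankMfull B hA) hAB mxrank0.
Qed.

Lemma full_col_rank_rsub m n p (V : 'M[F]_(m, n)) (Z : 'M[F]_(m, p)) :
  full_col_rank (row_mx V Z) -> full_col_rank Z.
Proof.
move=> hV; have ZE : Z = row_mx V Z *m col_mx 0 1%:M.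
  by rewrite mul_row_col mulmx0 mulmx1 add0r.
by rewrite /full_col_rank ZE mxrankMfull // rank_col_0mx mxrank1.
Qed.

Lemma mxrank_congr m n (V : 'M[F]_(m, n)) (M : 'M[F]_n) :
  full_col_rank V -> \rank (V *m M *m V^t*) = \rank M.
Proof.
move=> hV; rewrite mxrankMfree ?mxrankMfull //.
by rewrite /row_free mxrank_trmxC; apply/eqP.
Qed.

(** Block Gaussian elimination with the identity corner as pivot; the two outer factors are
    unitriangular, hence invertible. *)
Lemma mxrank_schur m n (a : 'M[F]_(m, n)) (b : 'M[F]_(n, m)) (D : 'M[F]_n) :
  \rank (block_mx 1%:M a b D) = (m + \rank (D - b *m a)%R)%N.
Proof.
have -> : block_mx 1%:M a b D = block_mx 1%:M 0 b 1%:M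
    *m block_mx 1%:M 0 0 (D - b *m a) *m block_mx 1%:M a 0 1%:M.
  rewrite !mulmx_block !(mul1mx, mulmx1, mul0mx, mulmx0, addr0, add0r).
  by rewrite addrC subrK.
rewrite mxrankMfree; last first.
  by rewrite row_free_unit unitmxE det_ublock !det1 mulr1 unitr1.
rewrite mxrankMfull; last first.
  by apply: mxrank_unit; rewrite unitmxE det_lblock !det1 mulr1 unitr1.
by rewrite rank_diag_block_mx mxrank1.
Qed.

End ConjTranspose.

(** * Gram matrices and positive definite matrices *)

Section PositiveDefinite.
Variable F : numClosedFieldType.

Lemma gram_ge0 n (g : 'cV[F]_n) : 0 <= (g^t* *m g) 0 0.
Proof.
rewrite mxE sumr_ge0 // => i _; rewrite !mxE mulrC.
exact: mul_conjC_ge0.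
Qed.

Lemma gram_eq0 n (g : 'cV[F]_n) : (g^t* *m g) 0 0 = 0 -> g = 0.
Proof.
rewrite mxE => /eqP; rewrite psumr_eq0 => [/allP g0|i _]; last first.
  by rewrite !mxE mulrC mul_conjC_ge0.
apply/colP=> i; have := g0 i (mem_index_enum _).
by rewrite !mxE /= mulrC mul_conjC_eq0 => /eqP.
Qed.

Lemma unitmx_inj n (W : 'M[F]_n) :
  (forall x : 'cV[F]_n, W *m x = 0 -> x = 0) -> W \in unitmx.
Proof.
move=> W0; rewrite -unitmx_tr -row_free_unit -kermx_eq0.
apply/eqP/row_matrixP=> i; rewrite row0; apply: trmx_inj; rewrite trmx0.
apply: W0; apply: trmx_inj; rewrite trmx_mul trmxK trmx0.
by apply/sub_kermxP; exact: row_sub.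
Qed.

Lemma posdefmx_unit n (W : 'M[F]_n) : posdefmx W -> W \in unitmx.
Proof.
move=> [_ pW]; apply: unitmx_inj => x Wx0; apply/eqP/negPn/negP => /pW.
by rewrite -mulmxA Wx0 mulmx0 mxE ltxx.
Qed.

Lemma posdefmx_congr n (T W : 'M[F]_n) :
  T \in unitmx -> posdefmx W -> posdefmx (T^t* *m W *m T).
Proof.
move=> uT [/hermsymmxP hW pW]; split=> [|x x0].
  by apply/hermsymmxP; rewrite !trmxC_mul trmxCK hW mulmxA.
rewrite !mulmxA -trmxC_mul -mulmxA; apply: pW.
by apply: contra_neq x0 => Tx0; rewrite -[x](mulKmx uT) Tx0 mulmx0.
Qed.

(** For Hermitian [W], the inverse is the congruence of [W] by [invmx W]. *)
Lemma posdefmx_inv n (W : 'M[F]_n) : posdefmx W -> posdefmx (invmx W).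
Proof.
move=> pW; have uW := posdefmx_unit pW.
have /(posdefmx_congr _) : posdefmx W by [].
move=> /(_ (invmx W)); rewrite unitmx_inv => /(_ uW).
by rewrite (hermsymmxP _ (invmx_hermsym pW.1)) mulVmx // mul1mx.
Qed.

Lemma posdefmx_block n (w : F) (W : 'M[F]_n) :
  0 < w -> posdefmx W -> posdefmx (block_mx (w%:M : 'M_1) 0 0 W).
Proof.
move=> w0 [/hermsymmxP hW pW]; split=> [|x].
  apply/hermsymmxP; rewrite tr_block_mx map_block_mx hW !trmxC0.
  by rewrite tr_scalar_mx map_scalar_mx /= (CrealP (gtr0_real w0)).
rewrite -[x]vsubmxK; set y := usubmx x; set z := dsubmx x => yz0.
rewrite tr_col_mx map_row_mx mul_row_block !mulmx0 addr0 add0r mul_row_col.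
rewrite mxE mul_mx_scalar -scalemxAl mxE.
have gy : 0 <= w * (y^t* *m y) 0 0 by rewrite mulr_ge0 ?gram_ge0 // ltW.
have [z0|/pW pz] := eqVneq z 0; last exact: ltr_wpDl.
rewrite z0 mulmx0 [X in _ + X]mxE addr0 lt_def gy andbT mulf_eq0 gt_eqF //=.
by apply/eqP => /gram_eq0 y0; rewrite y0 z0 col_mx0 eqxx in yz0.
Qed.

End PositiveDefinite.

(** * The Lyapunov equation with a triangular coefficient *)

Section Lyapunov.
Variable F : numClosedFieldType.

Definition lyap n (H W : 'M[F]_n) : 'M[F]_n := W *m H + H^t* *m W.

Lemma lyap_linear n (H : 'M[F]_n) : linear (lyap H).
Proof.
move=> a W W'; rewrite /lyap mulmxDl mulmxDr -scalemxAl -scalemxAr scalerDr.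
by rewrite addrACA.
Qed.

HB.instance Definition _ n (H : 'M[F]_n) :=
  GRing.isLinear.Build F 'M[F]_n 'M[F]_n _ (lyap H) (@lyap_linear n H).

Lemma addC_conj_gt0 (z : F) : 0 < 'Re z -> 0 < z + z^*.
Proof. by rewrite ReE pmulr_lgt0 // invr_gt0 ltr0n. Qed.

(** The diagonal of an upper triangular matrix is its spectrum, so the second condition places the
    spectrum in the open right half plane. *)
Definition antistable_trig n (H : 'M[F]_n) : Prop :=
  (forall i k : 'I_n, (k < i)%N -> H i k = 0) /\ forall i, 0 < 'Re (H i i).

Lemma lyap_inj n (H W : 'M[F]_n) :
  antistable_trig H -> lyap H W = 0 -> W = 0.
Proof.
move=> [tH rH] HW.
(* In entry (i, k) of the equation, W i k has the coefficient H k k + (H i i)^*,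
   and the other entries of W that occur come earlier. *)
suff W0 N : forall i k : 'I_n, (i + k < N)%N -> W i k = 0.
  by apply/matrixP=> i k; rewrite (W0 (i + k).+1) // mxE.
elim: N => // N IH i k; rewrite ltnS => ikN.
have /matrixP/(_ i k) := HW; rewrite !mxE (bigD1 k) //= [X in _ + X](bigD1 i) //=.
rewrite !big1 ?addr0; first 1 last.
- move=> l li; rewrite !mxE; have [lti|] := ltnP l i.
    by rewrite IH ?mulr0 // (leq_trans _ ikN) // ltn_add2r.
  rewrite leq_eqVlt val_eqE eq_sym (negPf li) /= => /tH ->.
  by rewrite conjC0 mul0r.
- move=> l lk; have [ltk|] := ltnP l k.
    by rewrite IH ?mul0r // (leq_trans _ ikN) // ltn_add2l.
  by rewrite leq_eqVlt val_eqE eq_sym (negPf lk) /= => /tH ->; rewrite mulr0.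
rewrite !mxE mulrC -mulrDl => /eqP; rewrite mulf_eq0 => /orP[/eqP H0|/eqP//].
(* The coefficient cannot vanish: conjugation preserves real parts, so its real part is a sum of two
   positive numbers. *)
have /(congr1 (fun z => 'Re z)) := H0.
rewrite raddfD /= Re_conj raddf0 => /eqP.
by rewrite gt_eqF // addr_gt0.
Qed.

(** An injective endomorphism of a finite-dimensional space is onto; [lin_mx] gives the matrix to
    invert. *)
Lemma lyap_surj n (H Q : 'M[F]_n) :
  antistable_trig H -> exists W, lyap H W = Q.
Proof.
move=> aH.
have uL : lin_mx (lyap H) \in unitmx.
  rewrite -row_free_unit -kermx_eq0; apply/eqP/row_matrixP=> i; rewrite row0.
  set u := row i _; suff u0 : vec_mx u = 0 by rewrite -[u]vec_mxK u0 linear0.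
  apply: (lyap_inj aH); apply: (can_inj mxvecK).
  rewrite -mul_vec_lin vec_mxK linear0.
  by apply/sub_kermxP; exact: row_sub.
exists (vec_mx (mxvec Q *m invmx (lin_mx (lyap H)))).
by apply: (can_inj mxvecK); rewrite -mul_vec_lin vec_mxK mulmxKV.
Qed.

(** Since [Q] is Hermitian, [W^t*] solves the same equation as [W], and solutions are unique. *)
Lemma lyap_hermsym n (H W Q : 'M[F]_n) :
  antistable_trig H -> Q \is hermsymmx -> lyap H W = Q -> W \is hermsymmx.
Proof.
move=> aH /hermsymmxP hQ WQ; apply/hermsymmxP/eqP; rewrite -subr_eq0; apply/eqP.
apply: (lyap_inj aH); rewrite linearB /= WQ -hQ -WQ /lyap.
by rewrite trmxCD !trmxC_mul trmxCK [X in _ - X]addrC subrr.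
Qed.

(* The form of the Hautus test for (H, G) that an upper triangular H allows:
   its eigenvalues are its diagonal entries. *)
Definition trig_observable q n (G : 'M[F]_(q, n)) (H : 'M[F]_n) : Prop :=
  forall (i : 'I_n) (x : 'cV[F]_n), H *m x = H i i *: x -> G *m x = 0 -> x = 0.

(** Change of basis: for invertible [T], [H'] is [H] in the basis of the columns of [T], while [W]
    transforms as a sesquilinear form. *)
Lemma lyap_congr n (T H H' W : 'M[F]_n) :
  H *m T = T *m H' -> lyap H' (T^t* *m W *m T) = T^t* *m lyap H W *m T.
Proof.
move=> HT; rewrite /lyap -!mulmxA -HT !mulmxA -trmxC_mul -HT trmxC_mul.
by rewrite mulmxDr mulmxDl !mulmxA.
Qed.

(* The shear T clears the off-diagonal blocks of W and keeps H triangular, so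
   that the Schur complement W1 satisfies the same hypotheses. *)
Lemma lyap_posdef q n (G : 'M[F]_(q, n)) (H W : 'M[F]_n) :
  antistable_trig H -> trig_observable G H ->
  W \is hermsymmx -> lyap H W = G^t* *m G -> posdefmx W.
Proof.
elim: n => [|n IH] in G H W *.
  by move=> _ _ hW _; split=> // x; rewrite flatmx0 eqxx.
move: G H W; rewrite -[n.+1]/(1 + n)%N => G H W [tH rH] obs /hermsymmxP hW HW.
have [s [r [H0 defH]]] : exists s r H0,
    H = block_mx (s%:M : 'M_1) r 0 H0.
  exists (H 0 0), (ursubmx H), (drsubmx H); rewrite -[LHS]submxK; congr block_mx.
    by rewrite [LHS]mx11_scalar !mxE; congr (H _ _)%:M; apply: val_inj.
  by apply/matrixP=> i k; rewrite !mxE tH // ord1.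
have [w [v [W0 defW]]] : exists w v W0,
    W = block_mx (w%:M : 'M_1) v (v^t*) W0.
  exists (W 0 0), (ursubmx W), (drsubmx W); rewrite -[LHS]submxK; congr block_mx.
    by rewrite [LHS]mx11_scalar !mxE; congr (W _ _)%:M; apply: val_inj.
  by rewrite -{1}hW; apply/matrixP=> i k; rewrite !mxE.
have [g [G0 defG]] : exists (g : 'cV_q) G0, G = row_mx g G0.
  by exists (lsubmx G), (rsubmx G); rewrite hsubmxK.
have s0 : H 0 0 = s.
  have -> : 0 = lshift n (0 : 'I_1) by apply: val_inj.
  by rewrite defH block_mxEul mxE eqxx.
(* This is the upper left entry of the Lyapunov equation. *)
have ws : w * (s + s^*) = (g^t* *m g) 0 0.
  have := HW; rewrite /lyap defH defW defG.
  rewrite !(tr_block_mx, map_block_mx, tr_row_mx, map_col_mx).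
  rewrite !mulmx_block mul_col_row add_block_mx => /eq_block_mx[+ _ _ _].
  rewrite trmxC0 mulmx0 mul0mx !addr0 tr_scalar_mx map_scalar_mx /= => <-.
  by rewrite -!scalar_mxM -raddfD mxE eqxx mulr1n mulrDr [s^* * _]mulrC.
(* If [g] were 0, the first unit vector would be an eigenvector of [H] killed by [G], against
   observability. *)
have g0 : 0 < (g^t* *m g) 0 0.
  rewrite lt_def gram_ge0 andbT; apply/eqP => /gram_eq0 g0.
  have /(congr1 usubmx)/matrixP/(_ 0 0) : col_mx (1%:M : 'M[F]_1) (0 : 'cV_n) = 0.
    apply: (obs 0); last by rewrite defG mul_row_col g0 mul0mx mulmx0 addr0.
    rewrite s0 defH mul_block_col !mulmx0 mul0mx !addr0 mulmx1.
    by rewrite scale_col_mx scaler0 scalemx1.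
  by rewrite col_mxKu !mxE => /eqP; rewrite oner_eq0.
have w0 : 0 < w.
  by rewrite -ws pmulr_lgt0 // -s0 addC_conj_gt0 in g0.
have wn0 : w != 0 by rewrite gt_eqF.
pose c := w^-1 *: v; pose T := block_mx 1%:M (- c) 0 1%:M : 'M[F]_(1 + n).
have wc : w%:M *m c = v by rewrite mul_scalar_mx scalerA divff // scale1r.
have cw : c^t* *m w%:M = v^t*.
  rewrite -[in RHS]wc trmxC_mul tr_scalar_mx map_scalar_mx /=.
  by rewrite (CrealP (gtr0_real w0)).
have uT : T \in unitmx by rewrite unitmxE det_ublock !det1 mulr1 unitr1.
pose W1 := W0 - v^t* *m c.
have WT : T^t* *m W *m T = block_mx w%:M 0 0 W1.
  rewrite defW -mulmxA mulmx_block !mulmx1 !mulmx0 !addr0 !mulmxN wc addNr.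
  rewrite tr_block_mx map_block_mx linearN /= map_mxN !trmxC1 trmxC0.
  rewrite mulmx_block !mul1mx !mul0mx !mulNmx cw addNr !mulmx0 oppr0 !add0r.
  by rewrite !addr0 addrC.
(* The upper right block of [H] after the change of basis [T]; the other blocks are unchanged. *)
pose r' := r - s%:M *m c + c *m H0.
have HT : H *m T = T *m block_mx s%:M r' 0 H0.
  rewrite defH !mulmx_block !mulmx1 !mul1mx !mulmx0 !mul0mx !addr0 !add0r.
  by rewrite mulmxN mulNmx addrK addrC.
have GT : G *m T = row_mx g (G0 - g *m c).
  by rewrite defG mul_row_block !mulmx1 mulmx0 addr0 mulmxN addrC.
(* In the new basis the upper right block of the equation ties [w r'] to the new [G] ([wr]), and the
   lower right block is the smaller Lyapunov equation for [W1]. *)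
have := lyap_congr W HT; rewrite WT HW mulmxA -trmxC_mul -mulmxA GT.
rewrite /lyap !(tr_block_mx, map_block_mx, tr_row_mx, map_col_mx).
rewrite !mulmx_block mul_col_row add_block_mx => /eq_block_mx[_ + _].
rewrite !(trmxC0, mulmx0, mul0mx, addr0, add0r) => wr W1eq.
have H0E i k : H (rshift 1 i) (rshift 1 k) = H0 i k by rewrite defH block_mxEdr.
have -> : W = (invmx T)^t* *m (T^t* *m W *m T) *m invmx T.
  by rewrite !mulmxA -trmxC_mul mulmxV // trmxC1 mul1mx mulmxK.
apply: posdefmx_congr; first by rewrite unitmx_inv.
rewrite WT; apply: posdefmx_block => //; apply: (IH (G0 - g *m c) H0) => //.
- split=> [i k ki|i]; first by rewrite -H0E tH // ltn_add2l.
  by rewrite -H0E.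
- move=> i x Hx Gx.
  (* By [wr], a vector killed by [G0 - g c] is killed by [r']. So [T] carries [col_mx 0 x] to a
     vector that satisfies the eigenvalue equation of [H] and is killed by [G]. *)
  have rx : r' *m x = 0.
    apply: (scalerI wn0); rewrite scaler0 scalemxAl -mul_scalar_mx wr.
    by rewrite -mulmxA Gx mulmx0.
  have /(congr1 (mulmx (invmx T))) : T *m col_mx 0 x = 0.
    apply: (obs (rshift 1 i)).
      rewrite mulmxA HT -mulmxA mul_block_col !mulmx0 rx !add0r Hx H0E.
      by rewrite scalemxAr scale_col_mx scaler0.
    by rewrite mulmxA GT mul_row_col mulmx0 add0r.
  by rewrite mulmx0 mulKmx // => /eqP; rewrite col_mx_eq0 => /andP[_ /eqP].
- have : (T^t* *m W *m T)^t* = T^t* *m W *m T.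
    by rewrite !trmxC_mul trmxCK hW mulmxA.
  rewrite WT tr_block_mx map_block_mx => /eq_block_mx[_ _ _ W1h].
  exact/hermsymmxP.
Qed.

End Lyapunov.

(** * The reduced Riccati equation and the rank of the residual *)

Section Riccati.
Variable F : numClosedFieldType.

(** Multiplying by [invmx Y] on both sides makes the quadratic equation linear in [invmx Y];
    multiplying by [Y] goes back. *)
Lemma reduced_riccati_lyap n q (G : 'M[F]_(q, n)) (H Y : 'M[F]_n) :
  Y \in unitmx ->
  (H *m Y + Y *m H^t* - Y *m (G^t* *m G) *m Y = 0 <->
   lyap H (invmx Y) = G^t* *m G).
Proof.
move=> uY; rewrite /lyap; split=> [/eqP|<-]; last first.
  by rewrite mulmxDr mulmxDl !mulmxA mulmxV // mul1mx mulmxKV // subrr.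
rewrite subr_eq0 => /eqP /(congr1 (fun M => invmx Y *m M *m invmx Y)).
by rewrite mulmxDr mulmxDl !mulmxA !mulVmx // !mul1mx !mulmxK.
Qed.

Lemma mxrank_riccati n m p k (A : 'M[F]_n) (B : 'M[F]_(n, m)) (C : 'M[F]_(p, n))
    (Z : 'M[F]_(n, k)) (h : 'M[F]_(p, k)) (H Y : 'M[F]_k) :
  full_col_rank (row_mx (C^t*) Z) ->
  A^t* *m Z = C^t* *m h + Z *m H -> Y \is hermsymmx ->
  \rank (riccati A B C (Z *m Y *m Z^t*)) =
    (p + \rank (H *m Y + Y *m H^t*
      - Y *m (Z^t* *m B *m B^t* *m Z + h^t* *m h) *m Y)%R)%N.
Proof.
move=> hV AZ /hermsymmxP hY.
set S := Z^t* *m B *m B^t* *m Z.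
have ZA : Z^t* *m A = h^t* *m C + H^t* *m Z^t*.
  by rewrite -[A]trmxCK -trmxC_mul AZ trmxCD !trmxC_mul trmxCK.
(* The corner 1 accounts for [C^t* C]. The lower right block has no term in [h]: the Schur
   complement supplies [- Y h^t* h Y]. *)
have -> : riccati A B C (Z *m Y *m Z^t*) = row_mx (C^t*) Z
    *m block_mx 1%:M (h *m Y) (Y *m h^t*) (H *m Y + Y *m H^t* - Y *m S *m Y)
    *m (row_mx (C^t*) Z)^t*.
  rewrite tr_row_mx map_col_mx trmxCK mul_row_block mul_row_col mulmx1 /riccati.
  rewrite !mulmxA AZ -(mulmxA _ _ A) ZA /S.
  rewrite !(mulmxDl, mulmxDr, mulmxN, mulNmx) !mulmxA.
  rewrite !addrA; congr (_ - _).
  by rewrite [LHS](ACl (5 * 3 * 1 * 2 * 4)%AC).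
rewrite (mxrank_congr _ hV) mxrank_schur; congr (_ + \rank _)%N.
rewrite mulmxDr mulmxDl opprD addrA; congr (_ - _).
by rewrite !mulmxA.
Qed.

End Riccati.

(** * Block indices and eigenvalues for column vectors *)

Section BlockIndices.
Variables (F : numClosedFieldType) (j p : nat).

(** Quotient and remainder by [p]; the existence of [i] forces [p] to be positive. *)
Lemma blkidxP (i : 'I_(j * p)) : exists a b, i = blkidx a b :> 'I_(j * p).
Proof.
have p0 : (0 < p)%N.
  by have := leq_ltn_trans (leq0n i) (ltn_ord i); rewrite muln_gt0 => /andP[].
have hi : (i %/ p < j)%N by rewrite ltn_divLR.
have hb : (i %% p < p)%N by rewrite ltn_mod.
by exists (Ordinal hi), (Ordinal hb); apply: val_inj; rewrite /= -divn_eq.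
Qed.

Lemma blk_col_mx (h : 'M[F]_(p, j * p)) (H : 'M[F]_(j * p)) (a c : 'I_j) :
  blk (col_mx h H : 'M_(j.+1 * p, j * p)) (lift ord0 a) c = blk H a c.
Proof.
apply/matrixP=> b b'; rewrite [LHS]mxE [RHS]mxE.
have -> : blkidx (lift ord0 a) b = rshift p (blkidx a b) :> 'I_(p + j * p).
  by apply: val_inj; rewrite /= /bump leq0n add1n mulSn addnA.
exact: col_mxEd.
Qed.

Lemma blk1 (a : 'I_j) : blk 1%:M a a = 1%:M :> 'M[F]_p.
Proof.
apply/matrixP=> b b'; rewrite !mxE; congr (_ %:R); congr (nat_of_bool _).
by rewrite -val_eqE /= eqn_add2l.
Qed.

End BlockIndices.

(** Passes from row eigenvectors to columns: [M - a I] has no left kernel, so it is invertible. *)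
Lemma non_eigenvalue_ker (F : numClosedFieldType) n
    (M : 'M[F]_n) (a : F) (x : 'cV[F]_n) :
  ~~ eigenvalue M a -> M *m x = a *: x -> x = 0.
Proof.
rewrite negbK kermx_eq0 row_free_unit => uM Mx; rewrite -[x](mulKmx uM).
by rewrite mulmxBl Mx mul_scalar_mx subrr mulmx0.
Qed.

(** * Structure of [H] and observability, read off from the BRAD *)

Section BlockRationalArnoldi.
Variables (F : numClosedFieldType) (n p j : nat).
Variables (A : 'M[F]_n) (V : 'M[F]_(n, p)) (Z : 'M[F]_(n, j * p)).
Variables (h : 'M[F]_(p, j * p)) (H : 'M[F]_(j * p)) (s : 'I_j -> F).
Hypothesis brad : BRAD_with_poles A (row_mx V Z : 'M_(n, j.+1 * p))
  (col_mx 0 1%:M : 'M_(j.+1 * p, j * p)) (col_mx h H : 'M_(j.+1 * p, j * p)) s.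

Lemma brad_full_rank : full_col_rank (row_mx V Z).
Proof. by case: brad => b [g [[_ [hV _]] _]]. Qed.

Lemma brad_recurrence : A *m Z = V *m h + Z *m H.
Proof.
case: brad => b [g [[AVK _] _]].
have : A *m row_mx V Z *m col_mx (0 : 'M_(p, j * p)) 1%:M
  = row_mx V Z *m col_mx h H := AVK.
by rewrite -mulmxA !mul_row_col mulmx0 mulmx1 add0r.
Qed.

(** The subdiagonal blocks of the BRAD matrices are the diagonal blocks of [1%:M] and [H], so the
    pole relation reads [beta I = gamma H_aa]. *)
Lemma brad_diag (a : 'I_j) : blk H a a = (s a)%:M.
Proof.
case: brad => b [g [[_ [_ [_ [_ bgP]]]] /(_ a) [ga ->]]].
case: (bgP a) => _ + _ _; rewrite /subdiag_blk !blk_col_mx blk1 => bg.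
by rewrite -[LHS](scalerK ga) -bg scalerA scalemx1 mulrC.
Qed.

Lemma brad_diagE (a : 'I_j) (b : 'I_p) : H (blkidx a b) (blkidx a b) = s a.
Proof.
by have /matrixP/(_ b b) := brad_diag a; rewrite !mxE eqxx mulr1n.
Qed.

(** Removing the block row [h] turns block Hessenberg into block triangular form; inside a diagonal
    block, [H] is scalar. *)
Lemma brad_trig (i k : 'I_(j * p)) : (k < i)%N -> H i k = 0.
Proof.
have [a [b ->]] := blkidxP i; have [c [d ->]] := blkidxP k => /= lt_ki.
have [lt_ca|le_ac] := ltnP c a.
  case: brad => be [g [[_ [_ [_ [/(_ (lift ord0 a) c) + _]]]] _]].
  rewrite blk_col_mx /= /bump add1n ltnS => /(_ lt_ca) /matrixP/(_ b d).
  by rewrite !mxE.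
have eac : a = c.
  apply/val_inj/eqP; rewrite eqn_leq le_ac /= leqNgt; apply/negP => lt_ac.
  have : (a.+1 * p <= c * p)%N by rewrite leq_mul2r lt_ac orbT.
  rewrite mulSn; have := ltn_ord b; lia.
subst c; have /matrixP/(_ b d) := brad_diag a; rewrite !mxE => ->.
by rewrite ltn_add2l in lt_ki; rewrite -val_eqE gtn_eqF.
Qed.

Lemma brad_antistable : (forall k, 0 < 'Re (s k)) -> antistable_trig H.
Proof.
move=> s0; split=> [|i]; first exact: brad_trig.
by have [a [b ->]] := blkidxP i; rewrite brad_diagE.
Qed.

(** If [H x = s x] and [h x = 0], the recurrence gives [A Z x = s Z x]. As [s] is not an eigenvalue
    of [A], [Z x = 0], and full column rank gives [x = 0]. *)
Lemma brad_observable m (G : 'M[F]_(m, j * p)) :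
  (forall k, ~~ eigenvalue A (s k)) ->
  trig_observable (col_mx G h) H.
Proof.
move=> hs i x; have [a [b ->]] := blkidxP i; rewrite brad_diagE => Hx.
rewrite mul_col_mx => /eqP; rewrite col_mx_eq0 => /andP[_ /eqP hx].
have Zx : Z *m x = 0.
  apply: (non_eigenvalue_ker (hs a)).
  rewrite mulmxA brad_recurrence mulmxDl -!mulmxA hx Hx mulmx0 add0r.
  by rewrite -scalemxAr.
have /(full_col_rank_inj brad_full_rank)/eqP :
    row_mx V Z *m col_mx 0 x = 0 by rewrite mul_row_col mulmx0 add0r.
by rewrite col_mx_eq0 => /andP[_ /eqP].
Qed.

End BlockRationalArnoldi.

(** * Rank characterization of the approximate Riccati solution *)

Theorem theorem4p1 (R : realType) (n m p j : nat)
  (A : 'M[R[i]]_n.+1) (B : 'M[R[i]]_(n.+1, m)) (C : 'M[R[i]]_(p, n.+1))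
  (q : {poly R[i]}) (s : 'I_j -> R[i])
  (Z : 'M[R[i]]_(n.+1, j * p)) (h : 'M[R[i]]_(p, j * p)) (H : 'M[R[i]]_(j * p))
  (hstanding : standing_assumptions A B C)
  (hj0 : (0 < j)%N) (hjn : (j < n.+1)%N)
  (hkrylov : full_col_rank (krylov_mx j (A^t*) (C^t*)))
  (hqsize : size q = j.+1)
  (hqroots : q = lead_coef q *: \prod_(k < j) ('X - (s k)%:P))
  (hs_pos : forall k : 'I_j, 0 < 'Re (s k))
  (hs_spec : forall k : 'I_j, ~~ eigenvalue (A^t*) (s k))
  (hBRAD : BRAD_with_poles (A^t*) (row_mx (C^t*) Z : 'M_(n.+1, j.+1 * p))
             (col_mx 0 1%:M : 'M_(j.+1 * p, j * p))
             (col_mx h H : 'M_(j.+1 * p, j * p)) s)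
  (hZ : blockspan Z = rational_krylov j (A^t*) (C^t*) q) :
  (exists! Y : 'M[R[i]]_(j * p), posdef_riccati_solution B Z h H Y) /\
  forall Yj : 'M[R[i]]_(j * p), posdef_riccati_solution B Z h H Yj ->
    let Xj := Z *m Yj *m Z^t* in
    [/\ \rank Xj = (j * p)%N,
        \rank (riccati A B C Xj) = p &
        forall Y : 'M[R[i]]_(j * p), Y \is hermsymmx ->
          \rank (Z *m Y *m Z^t*) = (j * p)%N ->
          \rank (riccati A B C (Z *m Y *m Z^t*)) = p ->
          Z *m Y *m Z^t* = Xj].
Proof.
have hV := brad_full_rank hBRAD; have AZ := brad_recurrence hBRAD.
have aH := brad_antistable hBRAD hs_pos.
have obs := brad_observable (G := B^t* *m Z) hBRAD hs_spec.
set G := col_mx _ _ in obs.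
have hG : Z^t* *m B *m B^t* *m Z + h^t* *m h = G^t* *m G.
  rewrite tr_col_mx map_row_mx mul_row_col trmxC_mul trmxCK.
  by rewrite !mulmxA.
have fZ := full_col_rank_rsub hV.
have [W WG] := lyap_surj (G^t* *m G) aH.
have hW : W \is hermsymmx.
  by apply: (lyap_hermsym aH _ WG); apply/hermsymmxP; rewrite trmxC_mul trmxCK.
have pW := lyap_posdef aH obs hW WG; have uW := posdefmx_unit pW.
(* Uniqueness is needed among all invertible solutions: the competitor in the last claim is not
   known to be positive definite. *)
have solW Y : Y \in unitmx -> H *m Y + Y *m H^t*
    - Y *m (Z^t* *m B *m B^t* *m Z + h^t* *m h) *m Y = 0 -> Y = invmx W.
  move=> uY; rewrite hG => /(reduced_riccati_lyap _ _ uY) YG.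
  rewrite -[Y]invmxK; congr invmx; apply/eqP; rewrite -subr_eq0; apply/eqP.
  by apply: (lyap_inj aH); rewrite linearB /= YG WG subrr.
split.
  exists (invmx W); split=> [|Y [/posdefmx_unit uY /(solW _ uY)] //].
  split; first exact: posdefmx_inv.
  rewrite hG; apply/reduced_riccati_lyap; rewrite ?unitmx_inv //.
  by rewrite invmxK.
move=> Yj [pYj sYj] /=; split.
- by rewrite mxrank_congr // mxrank_unit // posdefmx_unit.
- by rewrite (mxrank_riccati _ hV AZ pYj.1) sYj mxrank0 addn0.
(* The two rank hypotheses become [rank Y = j p], so [Y] is invertible, and [p + rank = p] for the
   reduced residual, which therefore vanishes. *)
move=> Y hY; rewrite (mxrank_congr _ fZ) (mxrank_riccati _ hV AZ hY) => rY.
move=> /eqP; rewrite -[X in _ == X]addn0 eqn_add2l mxrank_eq0 => /eqP sY.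
have uY : Y \in unitmx by rewrite -row_full_unit; apply/eqP.
by rewrite (solW _ uY sY) (solW _ (posdefmx_unit pYj) sYj).
Qed.
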